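(* Let $(p,<_p)$ be a weakly o-minimal pair over $A$, let $(D,<)$ be an $A$-definable linear order, and let $f:p(\mathfrak C)\to D$ be a relatively $A$-definable non-constant function. (i) There exists $E\in\mathcal E_p\setminus\{\mathbf 1_p\}$ such that one of the following two conditions holds for all $x_1,x_2$ realizing $p$: either $[x_1]_E<_p[x_2]_E\Rightarrow f(x_1)<f(x_2)$, or $[x_1]_E<_p[x_2]_E\Rightarrow f(x_1)>f(x_2)$. (ii) Let $q=\operatorname{tp}(f(a)/A)$ for some (any) $a\models p$, so that $f(p(\mathfrak C))=q(\mathfrak C)$. There exists $E\in\mathcal E_p\setminus\{\mathbf 1_p\}$ such that $f(E)=\{(f(x),f(y)):(x,y)\in E\}$ is an equivalence relation on $q(\mathfrak C)$, the function $f_E:p(\mathfrak C)/E\to q(\mathfrak C)/f(E)$, $f_E([x]_E)=[f(x)]_{f(E)}$, is well defined, and $f_E$ is strictly $(<_p,<)$-monotone.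
   Context: $T$ is a complete first-order theory (possibly multi-sorted) with monster model $\mathfrak C$; $A$ is a small parameter set. For a partial type $p$ over $A$, $p(\mathfrak C)$ is its set of realizations; relatively $B$-definable subsets, relations and functions (via graphs) on $p(\mathfrak C)$ are traces on $p(\mathfrak C)$ of $B$-definable sets. Convex sets/components are taken with respect to the linear order. $(p,<_p)$, with $p\in S(A)$ and $<_p$ a relatively $A$-definable linear order on $p(\mathfrak C)$, is a weakly o-minimal pair over $A$ if every relatively definable (any parameters) subset of $p(\mathfrak C)$ has finitely many convex components. $\mathcal E_p$ is the set of relatively $A$-definable equivalence relations on $p(\mathfrak C)$ (all are $<_p$-convex) and $\mathbf 1_p=p(\mathfrak C)^2$. For sets, $Y<Y'$ means $y<y'$ for all $y\in Y$, $y'\in Y'$; quotients by convex relations are ordered accordingly, and ''strictly monotone'' for $f_E$ refers to this ordering of classes. *)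

(* Defs.v *)
Set Warnings "-notation-overridden,-notation-incompatible-prefix".
From mathcomp Require Import all_boot.
From mathcomp Require Import all_classical.

Set Implicit Arguments.
Unset Strict Implicit.
Unset Printing Implicit Defensive.

Local Open Scope classical_set_scope.

Record language : Type := Language {
  sorts : Type;
  fsym : Type;
  fdom : fsym -> seq sorts;
  fcod : fsym -> sorts;
  rsym : Type;
  rdom : rsym -> seq sorts }.

(* Variables are organised in families [V : S -> Type]: [V s] is the type of
   the variables of sort [s].  [extend V t] is [V] with one more variable,
   of sort [t]. *)
Inductive extend (S : Type) (V : S -> Type) (t : S) : S -> Type :=
| Old s : V s -> extend V t s
| New : extend V t t.
Arguments Old {S V t s} _.
Arguments New {S V t}.

Definition novars (S : Type) : S -> Type := fun _ => void.

(* The variables of a finite tuple whose coordinates have the sorts listed in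
   [w]. *)
Fixpoint vars (S : Type) (w : seq S) : S -> Type :=
  if w is s :: w' then extend (vars w') s else @novars S.

Definition sumvars (S : Type) (V W : S -> Type) : S -> Type :=
  fun s => (V s + W s)%type.

Inductive term (L : language) (V : sorts L -> Type) : sorts L -> Type :=
| Var s : V s -> term V s
| App (g : fsym L) : (forall s, vars (fdom g) s -> term V s) -> term V (fcod g).

Inductive formula (L : language) (V : sorts L -> Type) : Type :=
| Eq s : term V s -> term V s -> formula V
| Rel (r : rsym L) : (forall s, vars (rdom r) s -> term V s) -> formula V
| Bot : formula V
| Imp : formula V -> formula V -> formula V
| All t : formula (extend V t) -> formula V.
Arguments Bot {L V}.

Definition Not (L : language) (V : sorts L -> Type) (phi : formula V) :
  formula V := Imp phi Bot.

(* [valuation M V] is the type of tuples of elements indexed by [V]; in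
   particular [valuation M (vars w)] is the Cartesian product of the sorts
   listed in [w]. *)
Definition valuation (S : Type) (M : S -> Type) (V : S -> Type) : Type :=
  forall s, V s -> M s.

Definition noval (S : Type) (M : S -> Type) : valuation M (@novars S) :=
  fun s v => match v with end.

Definition extend_val (S : Type) (M V : S -> Type) (t : S)
    (e : valuation M V) (a : M t) : valuation M (extend V t) :=
  fun s v => match v in extend _ _ s return M s with
             | Old s v => e s v
             | New => a
             end.

Definition join_val (S : Type) (M V W : S -> Type)
    (e : valuation M V) (e' : valuation M W) : valuation M (sumvars V W) :=
  fun s v => match v with inl v => e s v | inr w => e' s w end.

Record structure (L : language) : Type := Structure {
  carrier :> sorts L -> Type;
  carrier_inhabited : forall s, inhabited (carrier s);
  fun_interp : forall g : fsym L,
    valuation carrier (vars (fdom g)) -> carrier (fcod g);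
  rel_interp : forall r : rsym L, valuation carrier (vars (rdom r)) -> Prop }.

Definition tuples (L : language) (M : structure L) (w : seq (sorts L)) : Type :=
  valuation M (vars w).

Fixpoint eval (L : language) (M : structure L) (V : sorts L -> Type)
    (e : valuation M V) (s : sorts L) (u : term V s) : M s :=
  match u in term _ s return M s with
  | Var s v => e s v
  | App g args => fun_interp (fun s v => eval e (args s v))
  end.

Fixpoint sat (L : language) (M : structure L) (V : sorts L -> Type)
    (phi : formula V) : valuation M V -> Prop :=
  match phi with
  | Eq s u u' => fun e => eval e u = eval e u'
  | Rel r args => fun e => rel_interp (fun s v => eval e (args s v))
  | Bot => fun _ => False
  | Imp phi psi => fun e => sat phi e -> sat psi e
  | All t phi => fun e => forall a : M t, sat phi (extend_val e a)
  end.

Definition sentence (L : language) : Type := formula (@novars (sorts L)).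

Definition models (L : language) (M : structure L) (T : set (sentence L)) :=
  forall phi, T phi -> sat phi (noval M).

Definition entails (L : language) (T : set (sentence L)) (phi : sentence L) :=
  forall M : structure L, models M T -> sat phi (noval M).

Definition complete_theory (L : language) (T : set (sentence L)) : Prop :=
  (exists M : structure L, models M T) /\
  forall phi, entails T phi \/ entails T (Not phi).

Definition params (L : language) (M : structure L) : Type :=
  forall s, set (M s).

Definition all_params (L : language) (M : structure L) : params M :=
  fun s => [set: M s].

Definition param (L : language) (M : structure L) (B : params M) :
  sorts L -> Type := fun s => {b : M s | B s b}.

Definition param_val (L : language) (M : structure L) (B : params M) :
  valuation M (param B) := fun s b => proj1_sig b.

Definition formula_over (L : language) (M : structure L) (B : params M)
  (V : sorts L -> Type) : Type := formula (sumvars V (param B)).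

Definition sat_over (L : language) (M : structure L) (B : params M)
    (V : sorts L -> Type) (phi : formula_over B V) (e : valuation M V) : Prop :=
  sat phi (join_val e (param_val (B := B))).

Definition definable (L : language) (M : structure L) (B : params M)
    (x : seq (sorts L)) (X : set (tuples M x)) : Prop :=
  exists phi : formula_over B (vars x), X = [set a | sat_over phi a].

Definition definable2 (L : language) (M : structure L) (B : params M)
    (x y : seq (sorts L)) (R : set (tuples M x * tuples M y)) : Prop :=
  exists phi : formula_over B (sumvars (vars x) (vars y)),
    R = [set ab | sat_over phi (join_val ab.1 ab.2)].

Definition rel_definable (L : language) (M : structure L) (B : params M)
    (x : seq (sorts L)) (P X : set (tuples M x)) : Prop :=
  exists2 Y, definable B Y & X = Y `&` P.

Definition rel_definable2 (L : language) (M : structure L) (B : params M)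
    (x y : seq (sorts L)) (P : set (tuples M x)) (Q : set (tuples M y))
    (R : set (tuples M x * tuples M y)) : Prop :=
  exists2 Y, definable2 B Y & R = Y `&` (P `*` Q).

(* [f] is a function from [P] to [Q]; its values outside [P] are irrelevant. *)
Definition rel_definable_fun (L : language) (M : structure L) (B : params M)
    (x y : seq (sorts L)) (P : set (tuples M x)) (Q : set (tuples M y))
    (f : tuples M x -> tuples M y) : Prop :=
  set_fun P Q f /\
  rel_definable2 B P Q [set ab | P ab.1 /\ ab.2 = f ab.1].

Definition ptype (L : language) (M : structure L) (B : params M)
  (x : seq (sorts L)) : Type := set (formula_over B (vars x)).

Definition realizations (L : language) (M : structure L) (B : params M)
    (x : seq (sorts L)) (p : ptype B x) : set (tuples M x) :=
  [set a | forall phi, p phi -> sat_over phi a].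

Definition finitely_satisfiable (L : language) (M : structure L) (B : params M)
    (x : seq (sorts L)) (p : ptype B x) : Prop :=
  forall p0 : ptype B x, finite_set p0 -> p0 `<=` p -> realizations p0 !=set0.

Definition complete_type (L : language) (M : structure L) (B : params M)
    (x : seq (sorts L)) (p : ptype B x) : Prop :=
  finitely_satisfiable p /\ forall phi, p phi \/ p (Not phi).

Definition tp (L : language) (M : structure L) (B : params M)
    (x : seq (sorts L)) (a : tuples M x) : ptype B x :=
  [set phi | sat_over phi a].
Arguments tp {L M} B {x} a.

(* [K] represents a cardinal: [small K X] says that |X| < |K|. *)
Definition small (K X : Type) : Prop :=
  ([set: X] #<= [set: K])%card /\ ~ ([set: K] #<= [set: X])%card.

Definition small_params (K : Type) (L : language) (M : structure L)
  (B : params M) : Prop := small K {s : sorts L & param B s}.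

Definition saturated (K : Type) (L : language) (M : structure L) : Prop :=
  forall (B : params M) (x : seq (sorts L)) (p : ptype B x),
    small_params K B -> finitely_satisfiable p -> realizations p !=set0.

Definition automorphism (L : language) (M : structure L)
    (sigma : forall s, M s -> M s) : Prop :=
  [/\ forall s, bijective (sigma s),
      forall (g : fsym L) (a : tuples M (fdom g)),
        sigma _ (fun_interp a) = fun_interp (fun s v => sigma s (a s v)) &
      forall (r : rsym L) (a : tuples M (rdom r)),
        rel_interp a <-> rel_interp (fun s v => sigma s (a s v))].

Definition strongly_homogeneous (K : Type) (L : language) (M : structure L) :
    Prop :=
  forall (V : sorts L -> Type) (b c : valuation M V),
    small K {s : sorts L & V s} ->
    (forall phi : formula V, sat phi b <-> sat phi c) ->
    exists2 sigma : forall s, M s -> M s,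
      automorphism sigma & forall s v, sigma s (b s v) = c s v.

(* The first four conditions say that the cardinality of the language
   (including aleph_0) is smaller than that of [K]. *)
Record monster_model (K : Type) (L : language) (T : set (sentence L))
    (C : structure L) : Prop := MonsterModel {
  monster_nat : small K nat;
  monster_sort : small K (sorts L);
  monster_fsym : small K (fsym L);
  monster_rsym : small K (rsym L);
  monster_models : models C T;
  monster_saturated : saturated K C;
  monster_homogeneous : strongly_homogeneous K C }.

Record strict_linear_order_on (X : Type) (P : set X) (lt : set (X * X)) :
    Prop := StrictLinearOrderOn {
  slo_sub : lt `<=` P `*` P;
  slo_irr : forall a, ~ lt (a, a);
  slo_trans : forall a b c, lt (a, b) -> lt (b, c) -> lt (a, c);
  slo_total : forall a b, P a -> P b -> [\/ lt (a, b), a = b | lt (b, a)] }.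

Record equivalence_on (X : Type) (P : set X) (E : set (X * X)) : Prop :=
    EquivalenceOn {
  eqv_sub : E `<=` P `*` P;
  eqv_refl : forall a, P a -> E (a, a);
  eqv_sym : forall a b, E (a, b) -> E (b, a);
  eqv_trans : forall a b c, E (a, b) -> E (b, c) -> E (a, c) }.

Definition convex_for (X : Type) (lt : set (X * X)) (Y : set X) : Prop :=
  forall a b c, Y a -> Y c -> lt (a, b) -> lt (b, c) -> Y b.

Definition convex_components (X : Type) (lt : set (X * X)) (Y : set X) :
    set (set X) :=
  [set Z | [/\ Z !=set0, Z `<=` Y, convex_for lt Z &
     forall Z', Z' `<=` Y -> convex_for lt Z' -> Z `<=` Z' -> Z' = Z]].

Definition set_lt (X : Type) (lt : set (X * X)) (Y Z : set X) : Prop :=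
  forall a b, Y a -> Z b -> lt (a, b).

Definition eqclass (X : Type) (E : set (X * X)) (a : X) : set X :=
  [set b | E (a, b)].

Definition quotient (X : Type) (P : set X) (E : set (X * X)) : set (set X) :=
  eqclass E @` P.

Definition image_rel (X Y : Type) (f : X -> Y) (E : set (X * X)) :
  set (Y * Y) := [set (f ab.1, f ab.2) | ab in E].

Definition strictly_monotone_on_classes (X Y : Type) (ltX : set (X * X))
    (ltY : set (Y * Y)) (Q : set (set X)) (F : set X -> set Y) : Prop :=
  (forall U V, Q U -> Q V -> set_lt ltX U V -> set_lt ltY (F U) (F V)) \/
  (forall U V, Q U -> Q V -> set_lt ltX U V -> set_lt ltY (F V) (F U)).

Definition weakly_o_minimal_pair (L : language) (M : structure L)
    (A : params M) (x : seq (sorts L)) (p : ptype A x)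
    (lt : set (tuples M x * tuples M x)) : Prop :=
  let P := realizations p in
  [/\ complete_type p,
      rel_definable2 A P P lt,
      strict_linear_order_on P lt &
      forall X : set (tuples M x), rel_definable (@all_params L M) P X ->
        finite_set (convex_components lt X)].

Definition rel_definable_equivalences (L : language) (M : structure L)
    (A : params M) (x : seq (sorts L)) (p : ptype A x) :
    set (set (tuples M x * tuples M x)) :=
  [set E | rel_definable2 A (realizations p) (realizations p) E /\
           equivalence_on (realizations p) E].

Definition full_rel (L : language) (M : structure L)
    (A : params M) (x : seq (sorts L)) (p : ptype A x) :
  set (tuples M x * tuples M x) := realizations p `*` realizations p.

Definition definable_linear_order (L : language) (M : structure L)
    (A : params M) (y : seq (sorts L)) (D : set (tuples M y))
    (lt : set (tuples M y * tuples M y)) : Prop :=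
  [/\ definable A D, definable2 A lt & strict_linear_order_on D lt].

(* Main.v *)
(* Write R(a, b) for f a < f b.  As relatively definable sets have finitely many
   convex components and Aut(C/A) is transitive on P = p(C), after possibly
   reversing the order of D we have R(a, x) for all large x.  Let S(a) be the
   least initial segment of P outside which f exceeds f a.  Its complement is
   {x > z | f x > f a} for some z, so S and its complement are both
   type-definable over A, hence S is relatively A-definable by compactness.
   Clearly f c <= f a implies S(c) \subset S(a).  The key point is that S is also
   increasing for <_p: otherwise homogeneity produces arbitrarily long
   alternations of some {x | z \notin S(x)}.  Consequently b \in S(a) iff
   S(b) \subset S(a), so E = {(a, b) | S(a) = S(b)} is relatively A-definable; it
   contains the kernel of f, and x1 < x2 in distinct classes gives
   x2 \notin S(x1), hence f x1 < f x2. *)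
Require Import Defs.
Set Warnings "-notation-overridden,-notation-incompatible-prefix".
From mathcomp Require Import all_boot.
From mathcomp Require Import all_classical.
Local Open Scope classical_set_scope.

Set Implicit Arguments.
Unset Strict Implicit.

(** * Definable and type-definable sets *)

Fixpoint rename_term (L : language) (V W : sorts L -> Type)
    (r : forall s, V s -> W s) (s : sorts L) (u : term V s) : term W s :=
  match u in term _ s return term W s with
  | Var s v => Var (r s v)
  | App g args => App (fun s v => rename_term r (args s v))
  end.

Definition lift_renaming (S : Type) (V W : S -> Type)
    (r : forall s, V s -> W s) (t s : S) (v : extend V t s) : extend W t s :=
  match v in extend _ _ s return extend W t s with
  | Old s v => Old (r s v)
  | New => New
  end.

Fixpoint rename (L : language) (V W : sorts L -> Type)
    (r : forall s, V s -> W s) (phi : formula V) : formula W :=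
  match phi with
  | Eq s u u' => Eq (rename_term r u) (rename_term r u')
  | Rel g args => Rel (fun s v => rename_term r (args s v))
  | Bot => Bot
  | Imp phi psi => Imp (rename r phi) (rename r psi)
  | All t phi => All (rename (lift_renaming r (t := t)) phi)
  end.

Definition pull (S : Type) (M V W : S -> Type) (r : forall s, V s -> W s)
  (e : valuation M W) : valuation M V := fun s v => e s (r s v).

Lemma valuation_ext (S : Type) (M V : S -> Type) (e e' : valuation M V) :
  (forall s v, e s v = e' s v) -> e = e'.
Proof. by move=> h; apply/functional_extensionality_dep => s; apply/funext => v. Qed.

Lemma eval_rename (L : language) (M : structure L) (V W : sorts L -> Type)
    (r : forall s, V s -> W s) (e : valuation M W) s (u : term V s) :
  eval e (rename_term r u) = eval (pull r e) u.
Proof.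
elim: u => //= g args ih; congr fun_interp.
by apply: valuation_ext => s' v; rewrite ih.
Qed.

Lemma sat_rename (L : language) (M : structure L) (V W : sorts L -> Type)
    (r : forall s, V s -> W s) (phi : formula V) (e : valuation M W) :
  sat (rename r phi) e <-> sat phi (pull r e).
Proof.
elim: phi W r e => //= [V' s u u'|V' g args|V' phi ihp psi ihq|V' t phi ih] W r e.
- by rewrite !eval_rename.
- rewrite (_ : (fun s v => _) = (fun s v => eval (pull r e) (args s v))) //.
  by apply: valuation_ext => s v; rewrite eval_rename.
- by have := ihp _ r e; have := ihq _ r e; tauto.
- have E a : pull (lift_renaming r (t := t)) (extend_val e a) =
             extend_val (pull r e) a.
    by apply: valuation_ext => s [].
  by split=> h a; move: (h a); rewrite ih E.
Qed.

Lemma join_pull (S : Type) (M V W : S -> Type) (e : valuation M (sumvars V W)) :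
  e = join_val (pull (fun s => inl) e) (pull (fun s => inr) e).
Proof. by apply: valuation_ext => s []. Qed.

(** Arbitrary families of variables are allowed here, so that products, permuted coordinates and
    extra witness coordinates all reduce to renaming along [pull]. *)
Definition definable_in (L : language) (M : structure L) (A : params M)
    (V : sorts L -> Type) (X : set (valuation M V)) : Prop :=
  exists phi : formula_over A V, X = [set e | sat_over phi e].

Lemma definable_setC (L : language) (M : structure L) (A : params M)
    (V : sorts L -> Type) (X : set (valuation M V)) :
  definable_in A X -> definable_in A (~` X).
Proof. by move=> [phi ->]; exists (Not phi). Qed.

Lemma definable_setI (L : language) (M : structure L) (A : params M)
    (V : sorts L -> Type) (X Y : set (valuation M V)) :
  definable_in A X -> definable_in A Y -> definable_in A (X `&` Y).
Proof.
move=> [phi ->] [psi ->]; exists (Not (Imp phi (Not psi))).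
apply/seteqP; split=> e; rewrite /sat_over /=; first tauto.
by move=> h; apply: contrapT; tauto.
Qed.

Lemma definable_setT (L : language) (M : structure L) (A : params M)
    (V : sorts L -> Type) : definable_in A [set: valuation M V].
Proof. by exists (Imp Bot Bot); apply/seteqP; split=> e // _; rewrite /sat_over. Qed.

Definition old_param (S : Type) (V W B : S -> Type) (r : forall s, V s -> W s)
    (s : S) (v : sumvars V B s) : sumvars W B s :=
  match v with inl v => inl (r s v) | inr b => inr b end.

Lemma definable_pull (L : language) (M : structure L) (A : params M)
    (V W : sorts L -> Type) (r : forall s, V s -> W s)
    (X : set (valuation M V)) :
  definable_in A X -> definable_in A [set e | X (pull r e)].
Proof.
move=> [phi ->]; exists (rename (old_param r) phi).
have E (e : valuation M W) : pull (old_param r) (join_val e (param_val (B := A))) =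
    join_val (pull r e) (param_val (B := A)).
  by apply: valuation_ext => s [].
by apply/seteqP; split=> e; rewrite /sat_over /= sat_rename E.
Qed.

Lemma definable_ex1 (L : language) (M : structure L) (A : params M)
    (V : sorts L -> Type) (t : sorts L) (X : set (valuation M (extend V t))) :
  definable_in A X ->
  definable_in A [set e | exists a, X (extend_val e a)].
Proof.
move=> [phi ->].
(* [All] binds a variable outermost, over coordinates and parameters together, so the quantified
   variable has to move out of the left summand. *)
pose r s (v : sumvars (extend V t) (param A) s) :
    extend (sumvars V (param A)) t s :=
  match v with
  | inl v => match v in extend _ _ s return extend (sumvars V (param A)) t s with
             | Old s v => Old (inl v) | New => New end
  | inr b => Old (inr b) end.
exists (Not (All (Not (rename r phi)))).
have E (e : valuation M V) a :
    pull r (extend_val (join_val e (param_val (B := A))) a) =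
    join_val (extend_val e a) (param_val (B := A)).
  by apply: valuation_ext => s [[]|].
apply/seteqP; split=> e; rewrite /sat_over /=.
  by move=> [a h] /(_ a); rewrite sat_rename E.
move=> h; apply: contrapT => k; apply: h => a; rewrite sat_rename E => h.
by apply: k; exists a.
Qed.

Lemma definable_ex (L : language) (M : structure L) (A : params M)
    (w : seq (sorts L)) (V : sorts L -> Type)
    (X : set (valuation M (sumvars V (vars w)))) :
  definable_in A X ->
  definable_in A [set e | exists t : tuples M w, X (join_val e t)].
Proof.
elim: w V X => [|t w ih] V X dX.
  pose r s (v : sumvars V (vars [::]) s) : V s :=
    match v with inl v => v | inr v => match v with end end.
  have := definable_pull r dX; congr definable_in.
  apply/seteqP; split=> e /=.
    move=> h; exists (noval M).
    by rewrite (_ : join_val _ _ = pull r e) //; apply: valuation_ext => s [|[]].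
  move=> [t]; rewrite (_ : join_val _ _ = pull r e) //.
  by apply: valuation_ext => s [|[]].
pose r s (v : sumvars V (vars (t :: w)) s) : sumvars (extend V t) (vars w) s :=
  match v with
  | inl v => inl (Old v)
  | inr v => match v in extend _ _ s return sumvars (extend V t) (vars w) s with
             | Old s v => inr v | New => inl New end
  end.
have := definable_ex1 (ih _ _ (definable_pull r dX)); congr definable_in.
have E (e : valuation M V) a (b : tuples M w) :
    pull r (join_val (extend_val e a) b) =
    join_val e (extend_val b a : tuples M (t :: w)).
  by apply: valuation_ext => s [|[]].
apply/seteqP; split=> e /=.
  by move=> [a [b]]; rewrite E; exists (extend_val b a).
move=> [b h]; exists (b t New), (pull (fun s => Old) b).
rewrite E (_ : extend_val _ _ = b) //.
by apply: valuation_ext => s [].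
Qed.

Lemma definable_fiber (L : language) (M : structure L) (A : params M)
    (V W : sorts L -> Type) (X : set (valuation M (sumvars V W)))
    (c : valuation M W) :
  definable_in A X ->
  definable_in (@all_params L M) [set e | X (join_val e c)].
Proof.
move=> [phi ->].
pose r s (v : sumvars (sumvars V W) (param A) s) :
    sumvars V (param (@all_params L M)) s :=
  match v with
  | inl (inl v) => inl v
  | inl (inr v) => inr (exist _ (c s v) I)
  | inr b => inr (exist _ (proj1_sig b) I)
  end.
exists (rename r phi); apply/seteqP; split=> e; rewrite /sat_over /= sat_rename;
  by congr sat; apply: valuation_ext => s [[]|].
Qed.

(* The intersections of [A]-definable sets. *)
Definition type_definable (L : language) (M : structure L) (A : params M)
    (V : sorts L -> Type) (X : set (valuation M V)) : Prop :=
  forall e, ~ X e -> exists Y, [/\ definable_in A Y, X `<=` Y & ~ Y e].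

Lemma definable_type_definable (L : language) (M : structure L) (A : params M)
    (V : sorts L -> Type) (X : set (valuation M V)) :
  definable_in A X -> type_definable A X.
Proof. by move=> dX e nXe; exists X; split=> [||/nXe]. Qed.

Lemma type_definable_setI (L : language) (M : structure L) (A : params M)
    (V : sorts L -> Type) (X Y : set (valuation M V)) :
  type_definable A X -> type_definable A Y -> type_definable A (X `&` Y).
Proof.
move=> tX tY e /not_andP[/tX|/tY] [Z [dZ sZ nZ]]; exists Z; split=> // e'.
  by move=> [Xe Ye]; apply: sZ.
by move=> [Xe Ye]; apply: sZ.
Qed.

Lemma type_definable_pull (L : language) (M : structure L) (A : params M)
    (V W : sorts L -> Type) (r : forall s, V s -> W s)
    (X : set (valuation M V)) :
  type_definable A X -> type_definable A [set e | X (pull r e)].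
Proof.
move=> tX e /tX [Y [dY sY nY]]; exists [set e | Y (pull r e)].
by split=> //; [exact: definable_pull|move=> e' /= /sY].
Qed.

Lemma type_definable_realizations (L : language) (M : structure L)
    (A : params M) (x : seq (sorts L)) (p : ptype A x) :
  type_definable A (realizations p : set (valuation M (vars x))).
Proof.
move=> e /existsNP[phi /not_implyP[pphi nphi]].
by exists [set e | sat_over phi e]; split=> //; [exists phi|move=> e' /(_ phi pphi)].
Qed.

(** A formula on which [c] and [e] disagree, or its negation, holds of everything with the type of
    [c] and fails at [e]. *)
Lemma type_definable_same_type (L : language) (M : structure L)
    (A : params M) (V : sorts L -> Type) (c : valuation M V) :
  type_definable A
    [set e | forall phi : formula_over A V, sat_over phi c <-> sat_over phi e].
Proof.
move=> e /existsNP[phi h].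
have [cphi|ncphi] := pselect (sat_over phi c).
- exists [set e | sat_over phi e]; split; first by exists phi.
  + by move=> e' /= /(_ phi) [+ _]; apply.
  + by move=> ephi; apply: h.
- exists (~` [set e | sat_over phi e]); split.
  + by apply: definable_setC; exists phi.
  + by move=> e1 /= /(_ phi) [_ h1] /h1.
  + by move=> h1; apply: h; split=> [/ncphi|/h1].
Qed.

(** * Finite families of variables and compactness *)

(** Saturation speaks only of tuples indexed by some [vars w]; being a retract of such a family
    suffices to transfer points in both directions. *)
Definition finite_vars (S : Type) (V : S -> Type) : Prop :=
  exists w (i : forall s, V s -> vars w s) (j : forall s, vars w s -> V s),
    forall s, cancel (i s) (j s).

Lemma finite_vars_tuple (S : Type) (w : seq S) : finite_vars (vars w).
Proof. by exists w, (fun=> id), (fun=> id). Qed.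

Lemma finite_vars_retract (S : Type) (V W : S -> Type)
    (i : forall s, V s -> W s) (j : forall s, W s -> V s) :
  (forall s, cancel (i s) (j s)) -> finite_vars W -> finite_vars V.
Proof.
move=> ij [w [i' [j' ij']]].
exists w, (fun s v => i' s (i s v)), (fun s v => j s (j' s v)).
by move=> s v; rewrite ij' ij.
Qed.

Lemma finite_vars_extend (S : Type) (V : S -> Type) (t : S) :
  finite_vars V -> finite_vars (extend V t).
Proof.
move=> [w [i [j ij]]].
exists (t :: w), (lift_renaming i (t := t)), (lift_renaming j (t := t)).
by move=> s [s' v|//] /=; rewrite ij.
Qed.

Lemma finite_vars_sum (S : Type) (V : S -> Type) (w : seq S) :
  finite_vars V -> finite_vars (sumvars V (vars w)).
Proof.
move=> fV; elim: w => [|t w ih].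
  apply: (finite_vars_retract _ fV (V := sumvars V (vars [::]))
    (i := fun s v => match v with inl v => v | inr v => match v with end end)
    (j := fun s v => inl v)).
  by move=> s [|[]].
apply: (finite_vars_retract _ (finite_vars_extend t ih) (V := sumvars V (vars (t :: w)))
  (i := fun s v => match v with
     | inl v => Old (inl v)
     | inr v => match v in extend _ _ s
                  return extend (sumvars V (vars w)) t s with
                | Old s v => Old (inr v) | New => New end
     end)
  (j := fun s v => match v in extend _ _ s
                     return sumvars V (vars (t :: w)) s with
     | Old s v => match v with inl v => inl v | inr v => inr (Old v) end
     | New => inr New end)).
by move=> s [|[]].
Qed.

(** Let [p] consist of the formulas defining [A]-definable supersets of [X] or of [X']. Were [p]
    finitely satisfiable, saturation would give a point of both sets. So some finite part is
    inconsistent; its supersets of [X] intersect to [Y], those of [X'] to [Y']. *)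
Lemma compactness (K : Type) (L : language) (M : structure L) (A : params M)
    (V : sorts L -> Type) (X X' : set (valuation M V)) :
  saturated K M -> small_params K A -> finite_vars V ->
  type_definable A X -> type_definable A X' -> X `&` X' `<=` set0 ->
  exists Y Y', [/\ definable_in A Y, definable_in A Y', X `<=` Y, X' `<=` Y' &
    Y `&` Y' `<=` set0].
Proof.
move=> sat smallA [w [i [j ij]]] tX tX' XX'.
pose p : ptype A w := [set phi | exists Y,
  [/\ definable_in A Y, X `<=` Y \/ X' `<=` Y &
    forall e, sat_over phi e <-> Y (pull i e)]].
have pY Y : definable_in A Y -> X `<=` Y \/ X' `<=` Y ->
    forall e, realizations p e -> Y (pull i e).
  move=> dY sY e re; have [phi ephi] := definable_pull i dY.
  have E e' : sat_over phi e' <-> Y (pull i e').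
    by rewrite -[Y (pull i e')]/([set e | Y (pull i e)] e') ephi.
  by apply/E/re; exists Y.
have [|] := pselect (finitely_satisfiable p).
  move=> /(sat _ _ _ smallA)[e re].
  case: (XX' (pull i e)); split; apply: contrapT.
    by move=> /tX[Y [dY sY]]; apply; apply: pY => //; left.
  by move=> /tX'[Y [dY sY]]; apply; apply: pY => //; right.
move=> /existsNP[p0 /not_implyP[]].
move=> /(finite_seqP (T := {classic formula_over A (vars w)}))[l ->].
move=> /not_implyP[lp nr].
suff {nr} [Y [Y' [dY dY' sY sY' h]]] : exists Y Y',
    [/\ definable_in A Y, definable_in A Y', X `<=` Y, X' `<=` Y' &
      forall e, Y (pull i e) -> Y' (pull i e) ->
        forall phi, phi \in l -> sat_over phi e].
  (* A common point of [Y] and [Y'], carried along the retraction [j], would realize the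
     inconsistent finite part. *)
  exists Y, Y'; split=> // e [Ye Y'e]; apply: nr; exists (pull j e) => phi /= lphi.
  have E : pull i (pull j e) = e by apply: valuation_ext => s v; rewrite /pull ij.
  by apply: h; rewrite ?E.
elim: l lp => [|phi l ih] lp.
  by exists setT, setT; split=> //; exact: definable_setT.
have [|Y [Y' [dY dY' sY sY' h]]] := ih.
  by move=> psi /= psil; apply: lp; rewrite /= inE psil orbT.
have [|Z [dZ sZ hZ]] := lp phi; first by rewrite /= inE eqxx.
case: sZ => sZ; [exists (Y `&` Z), Y'|exists Y, (Y' `&` Z)].
all: split=> //; [exact: definable_setI| |]; try by move=> e Xe; split; auto.
  by move=> e [Ye Ze] Y'e psi; rewrite inE => /predU1P[->|]; [exact/hZ|exact: h].
by move=> e Ye [Y'e Ze] psi; rewrite inE => /predU1P[->|]; [exact/hZ|exact: h].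
Qed.

(** * Smallness and automorphisms *)

Lemma card_leTTP (X Y : Type) :
  ([set: X] #<= [set: Y])%card <-> exists f : X -> Y, injective f.
Proof.
split=> [/card_leP/injfunPex[f _ finj]|[f finj]].
  exists (fun a => set_val (f (SigSub (mem_set (I : [set: X] a))))).
  move=> a b /val_inj /finj; rewrite !inE => /(_ I I).
  by move=> /(congr1 set_val).
suff [F] : $| {injfun [set: X] >-> [set: Y]} | by exact: (inj_card_le F).
by apply/injfunPex; exists f => // a b _ _; exact: finj.
Qed.

Lemma small_inj (K X Y : Type) (f : X -> Y) :
  injective f -> small K Y -> small K X.
Proof.
move=> finj [/card_leTTP[g ginj] nYK]; split.
  by apply/card_leTTP; exists (g \o f); exact: inj_comp.
move=> /card_leTTP[h hinj]; apply: nYK; apply/card_leTTP.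
by exists (f \o h); exact: inj_comp.
Qed.

(** Hilbert's hotel: [s] sends [h n] to [h n.+1] and fixes everything else, which frees [h 0] for
    [None]. *)
Lemma option_inj_infinite (K : Type) (h : nat -> K) :
  injective h -> exists g : option K -> K, injective g.
Proof.
move=> hinj.
have /choice[s hs] (k : K) : exists k', (exists2 n, k = h n & k' = h n.+1) \/
    ((forall n, k <> h n) /\ k' = k).
  have [[n ->]|nk] := pselect (exists n, k = h n).
    by exists (h n.+1); left; exists n.
  by exists k; right; split=> // n kn; apply: nk; exists n.
have sinj : injective s.
  move=> a b.
  case: (hs a) => [[n an ->]|[na ->]]; case: (hs b) => [[m bm ->]|[nb ->]] //.
  - by move=> /hinj[nm]; rewrite an bm nm.
  - by move=> /esym /nb.
  - by move=> /na.
have s0 a : s a <> h 0.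
  by case: (hs a) => [[n _ ->]/hinj //|[na -> /na]].
exists (oapp s (h 0)) => -[a|] [b|] //=.
- by move=> /sinj ->.
- by move=> /s0.
- by move=> /esym /s0.
Qed.

Lemma small_option (K X : Type) : small K nat -> small K X -> small K (option X).
Proof.
move=> [/card_leTTP[h hinj] _] [/card_leTTP[f finj] nXK].
have [g ginj] := option_inj_infinite hinj.
split.
  apply/card_leTTP; exists (g \o omap f); apply: inj_comp => //.
  by move=> [a|] [b|] //= [/finj ->].
move=> /card_leTTP[k kinj]; apply: nXK; apply/card_leTTP.
have Finj : injective (k \o g) by exact: inj_comp.
(* An injection from [option K] to [option X] restricts to one from [K] to [X]: if some [Some a] is
   sent to [None], that [a] receives the image of [None] instead. *)
have /choice[s hs] (a : K) : exists b, (k \o g) (Some a) = Some b \/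
    (k \o g) (Some a) = None /\ (k \o g) None = Some b.
  case Ea : ((k \o g) (Some a)) => [b|]; first by exists b; left.
  case E0 : ((k \o g) None) => [b|]; first by exists b; right.
  by have := Finj _ _ (etrans Ea (esym E0)).
exists s => a b sab; have := hs a; have := hs b; rewrite sab.
move=> [Eb|[Eb E0]] [Ea|[Ea E0']].
- by have [] := Finj _ _ (etrans Ea (esym Eb)).
- by have := Finj _ _ (etrans Eb (esym E0')).
- by have := Finj _ _ (etrans Ea (esym E0)).
- by have [] := Finj _ _ (etrans Ea (esym Eb)).
Qed.

(** Adding a finite tuple to small parameters keeps the family small, as needed to apply strong
    homogeneity over [A]. *)
Lemma small_tuple_sum (K S : Type) (w : seq S) (V : S -> Type) :
  small K nat -> small K {s : S & V s} ->
  small K {s : S & sumvars (vars w) V s}.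
Proof.
move=> Knat smallV; elim: w => [|t w ih].
  pose f (u : {s : S & sumvars (vars [::]) V s}) : {s : S & V s} :=
    existT V (projT1 u)
      (match projT2 u with inl v => match v with end | inr v => v end).
  pose g (u : {s : S & V s}) : {s : S & sumvars (vars [::]) V s} :=
    existT (sumvars (vars [::]) V) (projT1 u) (inr (projT2 u)).
  suff fK : cancel f g by exact: small_inj (can_inj fK) smallV.
  by move=> [s [[]|v]].
pose Y := {s : S & sumvars (vars w) V s}.
pose f (u : {s : S & sumvars (vars (t :: w)) V s}) : option Y :=
  match projT2 u with
  | inl v => match v with Old s v => Some (existT _ s (inl v)) | New => None end
  | inr v => Some (existT _ (projT1 u) (inr v))
  end.
pose g (o : option Y) : {s : S & sumvars (vars (t :: w)) V s} :=
  match o with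
  | Some (existT s (inl v)) => existT _ s (inl (Old v))
  | Some (existT s (inr v)) => existT _ s (inr v)
  | None => existT _ t (inl New)
  end.
suff fK : cancel f g by exact: small_inj (can_inj fK) (small_option Knat ih).
by move=> [s [[]|v]].
Qed.

Lemma small_tuple_pair_sum (K S : Type) (w : seq S) (V : S -> Type) :
  small K nat -> small K {s : S & V s} ->
  small K {s : S & sumvars (sumvars (vars w) (vars w)) V s}.
Proof.
move=> Knat smallV.
pose Y := {s : S & sumvars (vars w) (sumvars (vars w) V) s}.
pose f (u : {s : S & sumvars (sumvars (vars w) (vars w)) V s}) : Y :=
  existT _ (projT1 u) (match projT2 u with
    | inl (inl v) => inl v | inl (inr v) => inr (inl v) | inr v => inr (inr v)
    end).
pose g (u : Y) : {s : S & sumvars (sumvars (vars w) (vars w)) V s} :=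
  existT _ (projT1 u) (match projT2 u with
    | inl v => inl (inl v) | inr (inl v) => inl (inr v) | inr (inr v) => inr v
    end).
have fK : cancel f g by move=> [s [[]|v]].
apply: small_inj (can_inj fK) _.
exact: (small_tuple_sum w Knat (small_tuple_sum w Knat smallV)).
Qed.

(** * Automorphisms and invariance of definable sets *)

Definition act (S : Type) (M V : S -> Type) (sigma : forall s, M s -> M s)
  (e : valuation M V) : valuation M V := fun s v => sigma s (e s v).

Lemma eval_automorphism (L : language) (M : structure L)
    (sigma : forall s, M s -> M s) (V : sorts L -> Type) (e : valuation M V)
    (s : sorts L) (u : term V s) :
  automorphism sigma -> eval (act sigma e) u = sigma s (eval e u).
Proof.
move=> [_ sf _]; elim: u => //= g args ih; rewrite sf; congr fun_interp.
by apply: valuation_ext => s' v; rewrite ih.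
Qed.

Lemma sat_automorphism (L : language) (M : structure L)
    (sigma : forall s, M s -> M s) (V : sorts L -> Type) (phi : formula V)
    (e : valuation M V) :
  automorphism sigma -> sat phi (act sigma e) <-> sat phi e.
Proof.
move=> auts; have [sb _ sr] := auts.
elim: phi e => //= [V' s u u'|V' g args|V' phi ihp psi ihq|V' t phi ih] e.
- rewrite !eval_automorphism //; split=> [|-> //].
  by apply: bij_inj.
- rewrite [X in _ <-> X]sr.
  rewrite (_ : (fun s v => eval _ _) = (fun s v => sigma s (eval e (args s v)))) //.
  by apply: valuation_ext => s v; rewrite eval_automorphism.
- by have := ihp e; have := ihq e; tauto.
- have E a : extend_val (act sigma e) (sigma t a) = act sigma (extend_val e a).
    by apply: valuation_ext => s [].
  split=> h a; first by rewrite -ih -E.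
  by have [g _ gK] := sb t; rewrite -(gK a) E ih.
Qed.

Definition automorphism_over (L : language) (M : structure L) (A : params M)
    (sigma : forall s, M s -> M s) : Prop :=
  automorphism sigma /\ forall s (b : M s), A s b -> sigma s b = b.

Lemma definable_automorphism (L : language) (M : structure L) (A : params M)
    (sigma : forall s, M s -> M s) (V : sorts L -> Type)
    (X : set (valuation M V)) (e : valuation M V) :
  automorphism_over A sigma -> definable_in A X -> X (act sigma e) <-> X e.
Proof.
move=> [auts fixA] [phi ->] /=; rewrite /sat_over.
rewrite -[X in _ <-> X](sat_automorphism phi _ auts).
rewrite (_ : act sigma (join_val _ _) = join_val (act sigma e) (param_val (B := A))) //.
by apply: valuation_ext => s [v|[b Ab]] //=; rewrite /act /= /param_val /= fixA.
Qed.

Lemma act_surj (L : language) (M : structure L) (sigma : forall s, M s -> M s)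
    (V : sorts L -> Type) (e : valuation M V) :
  automorphism sigma -> exists e', act sigma e' = e.
Proof.
move=> [sb _ _].
have h s v : exists a, sigma s a = e s v by have [g _ gK] := sb s; exists (g (e s v)).
exists (fun s v => projT1 (cid (h s v))).
by apply: valuation_ext => s v; rewrite /act; case: cid.
Qed.

(** The elements of [A] are appended to both tuples as further coordinates, so the automorphism
    supplied by homogeneity has to fix them. *)
Lemma same_type_automorphism (K : Type) (L : language) (M : structure L)
    (A : params M) (V : sorts L -> Type) (e e' : valuation M V) :
  strongly_homogeneous K M -> small K {s : sorts L & sumvars V (param A) s} ->
  (forall phi : formula_over A V, sat_over phi e <-> sat_over phi e') ->
  exists2 sigma, automorphism_over A sigma & act sigma e = e'.
Proof.
move=> hom smallV /(hom _ _ _ smallV)[sigma auts sE]; exists sigma.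
  by split=> // s b Ab; exact: (sE s (inr (exist _ b Ab))).
by apply: valuation_ext => s v; exact: (sE s (inl v)).
Qed.

(** * Weakly o-minimal homogeneous orders *)

(** A chain z < b1 < a1 < b2 < a2 < ... with every b outside [Y] and every a inside: the a's lie in
    [n] different convex components. *)
Fixpoint alternates (X : Type) (lt : set (X * X)) (Y : set X) (n : nat) (z : X) :
    Prop :=
  if n is n'.+1 then
    exists b a, [/\ lt (z, b), ~ Y b, lt (b, a), Y a & alternates lt Y n' a]
  else True.

(** The component of [a] consists of the [u] in [Y] such that every point between [a] and [u] is in
    [Y]. A point below [a] and outside [Y] therefore lies below the whole component. *)
Lemma mem_convex_component (X : Type) (P : set X) (lt : set (X * X))
    (Y : set X) (a : X) :
  strict_linear_order_on P lt -> Y `<=` P -> Y a ->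
  exists Z, [/\ convex_components lt Y Z, Z a &
    forall u b, Z u -> lt (b, a) -> ~ Y b -> lt (b, u)].
Proof.
move=> [sub irr tr tot] YP Ya.
pose Z := [set u | Y u /\
  forall c, lt (a, c) /\ lt (c, u) \/ lt (u, c) /\ lt (c, a) -> Y c].
have aZ : Z a by split=> // c [] [ac ca]; case: (irr a); [exact: tr ca|exact: tr ca].
exists Z; split=> //.
  split; first by exists a.
  - by move=> u [].
  - move=> u b v [Yu hu] [Yv hv] ub bv.
    have Pb : P b by have [] := sub _ ub.
    split.
      have [ab|<- //|ba] := tot a b (YP _ Ya) Pb; first by apply: hv; left.
      by apply: hu; right.
    move=> c [[ac cb]|[bc ca]]; first by apply: hv; left; split=> //; exact: tr bv.
    by apply: hu; right; split=> //; exact: tr bc.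
  - move=> Z' Z'Y cZ' ZZ'; apply/seteqP; split=> // w Z'w.
    split; first exact: Z'Y.
    move=> c [[ac cw]|[wc ca]]; apply: Z'Y.
      by apply: (cZ' a c w) => //; exact: ZZ'.
    by apply: (cZ' w c a) => //; exact: ZZ'.
move=> u b [Yu hu] ba nYb.
have Pb : P b by have [] := sub _ ba.
have [ub|E|//] := tot u b (YP _ Yu) Pb.
  by case: nYb; apply: hu; right.
by rewrite E in Yu.
Qed.

Lemma alternates_bound (X : Type) (P : set X) (lt : set (X * X)) (Y : set X) :
  strict_linear_order_on P lt -> Y `<=` P ->
  finite_set (convex_components lt Y) ->
  exists n, forall z, ~ alternates lt Y n z.
Proof.
move=> slo YP /finite_seqP[s sE]; have [_ irr tr _] := slo.
exists (size s).+1 => z altz.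
(* Requiring the listed components to lie above [z] makes the next one new: it contains [a], while
   those already listed lie strictly above [a]. *)
suff [l [ul ll lc _]] : exists l : seq (set X), [/\ uniq l, size l = (size s).+1,
    {subset l <= s} & forall Z, Z \in l -> forall u, Z u -> lt (z, u)].
  by have := uniq_leq_size ul lc; rewrite ll ltnn.
elim: (size s).+1 z altz => [|n ih] z /=; first by exists [::].
move=> [b [a [zb nYb ba Ya /ih [l [ul ll lc lz]]]]].
have [Z [cZ Za Zb]] := mem_convex_component slo YP Ya.
exists (Z :: l); split.
- rewrite /= ul andbT; apply/negP => /lz /(_ a Za).
  exact: irr.
- by rewrite /= ll.
- move=> Z'; rewrite inE => /predU1P[->|/lc //].
  by have : [set` s] Z by rewrite -sE.
- move=> Z'; rewrite inE => /predU1P[-> u Zu|/lz h u /h au].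
    by apply: tr zb _; exact: Zb.
  by apply: tr (tr _ _ _ zb ba) au.
Qed.

(** Otherwise points of [Y] and points outside [Y] occur above every point, which yields arbitrarily
    long alternations. *)
Lemma eventually_constant (X : Type) (P : set X) (lt : set (X * X))
    (Y : set X) (a0 : X) :
  strict_linear_order_on P lt -> Y `<=` P ->
  finite_set (convex_components lt Y) -> P a0 ->
  exists2 z, P z &
    (forall x, lt (z, x) -> Y x) \/ (forall x, lt (z, x) -> ~ Y x).
Proof.
move=> slo YP fY Pa0; have [n nalt] := alternates_bound slo YP fY.
apply: contrapT => h.
have step z : P z -> (exists2 x, lt (z, x) & Y x) /\ (exists2 x, lt (z, x) & ~ Y x).
  move=> Pz; split; apply: contrapT => k; apply: h; exists z => //.
    by right=> x zx Yx; apply: k; exists x.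
  by left=> x zx; apply: contrapT => nYx; apply: k; exists x.
apply: (nalt a0); elim: n a0 Pa0 {nalt} => //= n ih z Pz.
have [_ [b zb nYb]] := step z Pz.
have [_ Pb] := slo_sub slo zb.
have [[a ba Ya] _] := step b Pb.
by exists b, a; split=> //; apply: ih; exact: YP.
Qed.

(* With [R (a, b)] read as [f a < f b]: the smallest initial segment of [P]
   outside which [f] exceeds [f a]. *)
Definition reach (X : Type) (P : set X) (lt R : set (X * X)) (a : X) : set X :=
  [set x | P x /\ exists y, [/\ P y, ~ lt (y, x) & ~ R (a, y)]].

(** This keeps of an automorphism over [A] only what the order-theoretic argument uses. [R] is
    respected only on [P], because the values of [f] outside [P] are arbitrary. *)
Record symmetry (X : Type) (P : set X) (lt R : set (X * X)) (sigma : X -> X) :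
    Prop := Symmetry {
  sym_dom : forall a, P (sigma a) <-> P a;
  sym_lt : forall a b, lt (sigma a, sigma b) <-> lt (a, b);
  sym_rel : forall a b, P a -> P b -> R (sigma a, sigma b) <-> R (a, b);
  sym_surj : forall b, exists a, sigma a = b }.

Definition homogeneous (X : Type) (P : set X) (lt R : set (X * X)) : Prop :=
  forall a b, P a -> P b -> exists2 sigma, symmetry P lt R sigma & sigma a = b.

(** With [R (a, b)] read as f a < f b, the axioms say that the complement of [R] is a preorder on
    [P]; points with equal values are permitted. *)
Record weak_order_on (X : Type) (P : set X) (R : set (X * X)) : Prop :=
    WeakOrderOn {
  wo_irr : forall a, P a -> ~ R (a, a);
  wo_negtrans : forall a b c, P a -> P b -> P c ->
    ~ R (a, b) -> ~ R (b, c) -> ~ R (a, c) }.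

Lemma reach_symmetry (X : Type) (P : set X) (lt R : set (X * X))
    (sigma : X -> X) (a x : X) :
  symmetry P lt R sigma -> P a ->
  reach P lt R (sigma a) (sigma x) <-> reach P lt R a x.
Proof.
move=> [sP slt sR ss] Pa; split=> -[Px [y [Py ylt yR]]].
  have [y' E] := ss y; rewrite -{}E in Py ylt yR.
  move/sP in Py; split; first exact/sP.
  exists y'; split=> //; first by move=> /slt.
  by move=> /(sR _ _ Pa Py).
split; first exact/sP.
exists (sigma y); split; [exact/sP|by move=> /slt|].
by move=> /(sR _ _ Pa Py).
Qed.

Lemma alternates_symmetry (X : Type) (P : set X) (lt R : set (X * X))
    (sigma : X -> X) (Y Y' : set X) (n : nat) (z : X) :
  symmetry P lt R sigma -> (forall x, Y' (sigma x) <-> Y x) ->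
  alternates lt Y n z -> alternates lt Y' n (sigma z).
Proof.
move=> [_ slt _ _] YY'; elim: n z => //= n ih z [b [a [zb nYb ba Ya /ih altn]]].
by exists (sigma b), (sigma a); split=> //; [exact/slt|move=> /YY'|exact/slt|exact/YY'].
Qed.

Lemma reach_refl (X : Type) (P : set X) (lt R : set (X * X)) (a : X) :
  strict_linear_order_on P lt -> weak_order_on P R -> P a -> reach P lt R a a.
Proof.
move=> slo wo Pa; split=> //; exists a; split=> //; first exact: (slo_irr slo).
exact: (wo_irr wo).
Qed.

Lemma reach_initial (X : Type) (P : set X) (lt R : set (X * X)) (a x x' : X) :
  strict_linear_order_on P lt -> lt (x', x) -> reach P lt R a x ->
  reach P lt R a x'.
Proof.
move=> slo x'x [_ [y [Py nyx nR]]]; have [Px' _] := slo_sub slo x'x.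
by split=> //; exists y; split=> // yx'; apply: nyx; exact: (slo_trans slo yx' x'x).
Qed.

Lemma lt_reach (X : Type) (P : set X) (lt R : set (X * X)) (a x z : X) :
  strict_linear_order_on P lt -> P z -> reach P lt R a x ->
  ~ reach P lt R a z -> lt (x, z).
Proof.
move=> slo Pz ax naz; have [Px _] := ax.
have [//|E|zx] := slo_total slo Px Pz; first by rewrite E in ax.
by case: naz; exact: reach_initial ax.
Qed.

Lemma rel_of_not_reach (X : Type) (P : set X) (lt R : set (X * X)) (a x : X) :
  strict_linear_order_on P lt -> P x -> ~ reach P lt R a x -> R (a, x).
Proof.
move=> slo Px nax; apply: contrapT => nR; apply: nax; split=> //.
by exists x; split=> //; exact: (slo_irr slo).
Qed.

Lemma reach_le (X : Type) (P : set X) (lt R : set (X * X)) (a b : X) :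
  weak_order_on P R -> P a -> P b -> ~ R (a, b) ->
  reach P lt R b `<=` reach P lt R a.
Proof.
move=> wo Pa Pb nab x [Px [y [Py nyx nby]]]; split=> //; exists y; split=> //.
exact: (wo_negtrans wo) nby.
Qed.

(** This turns non-membership in the reach into a positive condition beyond [z]. If it failed, above
    every point of the reach there would be a further [x] in it with [R (a, x)]; a witness for [x]
    lies above [x], violates [R (a, _)] and is again in the reach. The set of [x] with [R (a, x)]
    would then alternate without bound. *)
Lemma reach_tail (X : Type) (P : set X) (lt R : set (X * X)) (a : X) :
  strict_linear_order_on P lt -> weak_order_on P R -> P a ->
  finite_set (convex_components lt [set x | P x /\ R (a, x)]) ->
  exists2 z, reach P lt R a z &
    forall x, lt (z, x) -> R (a, x) -> ~ reach P lt R a x.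
Proof.
move=> slo wo Pa fin.
have YP : [set x | P x /\ R (a, x)] `<=` P by move=> x [].
have [n nalt] := alternates_bound slo YP fin.
apply: contrapT => h.
have step z : reach P lt R a z -> exists x,
    [/\ lt (z, x), R (a, x) & reach P lt R a x].
  move=> az; apply: contrapT => k; apply: h; exists z => // x zx Rax ax.
  by apply: k; exists x.
have step2 z : reach P lt R a z -> exists b,
    [/\ lt (z, b), ~ R (a, b) & reach P lt R a b].
  move=> /step[x [zx Rax [Px [y [Py nyx nRay]]]]].
  exists y; split=> //.
    have [yx|E|] := slo_total slo Py Px; [by []|by rewrite E in nRay|].
    exact: (slo_trans slo zx).
  by split=> //; exists y; split=> //; exact: (slo_irr slo).
apply: (nalt a); have := reach_refl slo wo Pa.
elim: n {2 4}a {nalt} => //= n ih z az.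
have [b [zb nRb ab]] := step2 z az.
have [x [bx Rx ax]] := step b ab.
exists b, x; split=> //; first by move=> [].
  by case: ax.
exact: ih.
Qed.

(* If [reach b] is properly contained in [reach a] for some [a < b], then by
   homogeneity every [y] has such a partner [y']; choosing [y] in
   [reach a \ reach b] with [~ R (a, y)] puts [reach y' `<` reach y] between
   [reach b] and [reach a].  Iterating, [z] in the innermost difference makes
   [{x | z \notin reach x}] alternate arbitrarily often. *)
Lemma reach_monotone (X : Type) (P : set X) (lt R : set (X * X)) (a b : X) :
  strict_linear_order_on P lt -> weak_order_on P R -> homogeneous P lt R ->
  (forall z, P z ->
    finite_set (convex_components lt [set x | P x /\ ~ reach P lt R x z])) ->
  lt (a, b) -> reach P lt R a `<=` reach P lt R b.
Proof.
move=> slo wo hom fin ab z0 az0; apply: contrapT => nbz0.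
have [Pa Pb] := slo_sub slo ab; have [Pz0 _] := az0.
pose bad a b := lt (a, b) /\ exists2 z, reach P lt R a z & ~ reach P lt R b z.
have badE y : P y -> exists y', bad y y'.
  move=> /(hom _ _ Pa)[sigma ssig <-]; exists (sigma b); split.
    exact/(sym_lt ssig).
  exists (sigma z0); first exact/(reach_symmetry _ ssig Pa).
  by move=> /(reach_symmetry _ ssig Pb).
(* The bound for the single point [z0] serves all [z], since a symmetry moves [z] to [z0].
   Uniformity matters because the induction below finds its [z] only at the innermost stage. *)
have [n nalt] : exists n, forall z t, P z ->
    ~ alternates lt [set x | P x /\ ~ reach P lt R x z] n t.
  have [n nalt] := alternates_bound slo
    (@subIsetl _ P [set x | ~ reach P lt R x z0]) (fin _ Pz0).
  exists n => z t Pz; have [sigma ssig E] := hom _ _ Pz Pz0.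
  move=> altn; apply: (nalt (sigma t)).
  apply: (alternates_symmetry ssig _ altn) => x /=; rewrite -E.
  have E2 : P x -> reach P lt R (sigma x) (sigma z) <-> reach P lt R x z.
    by move=> Px; exact: reach_symmetry.
  split=> -[].
    by move=> /(sym_dom ssig) Px; rewrite E2.
  by move=> Px; rewrite E2 //; split=> //; exact/(sym_dom ssig).
suff [v [Pv _ _ /(nalt _ _ Pv)//]] : exists z, [/\ P z, reach P lt R a z,
    ~ reach P lt R b z &
    alternates lt [set x | P x /\ ~ reach P lt R x z] n b].
have {nbz0 az0} badab : bad a b by split=> //; exists z0.
elim: n a b badab {z0 Pz0 Pa Pb ab nalt} => [|n ih] a b [ab [z az nbz]].
  by exists z; have [] := az.
have [Pa Pb] := slo_sub slo ab.
have [Pz [y [Py nyz nRay]]] := az.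
have nby : ~ reach P lt R b y.
  move=> rby; apply: nbz.
  have [yz|<- //|zy] := slo_total slo Py Pz; first by [].
  exact: reach_initial rby.
have [y' [yy' [u yu ny'u]]] := badE y Py.
have [_ Py'] := slo_sub slo yy'.
have [v [Pv yv ny'v altn]] := ih y y' (conj yy' (ex_intro2 _ _ u yu ny'u)).
have y'v : lt (y', v) by apply: lt_reach ny'v => //; exact: reach_refl.
have nbv : ~ reach P lt R b v.
  move=> bv; apply: nby; apply: reach_initial bv => //.
  exact: (slo_trans slo yy' y'v).
have bbefore : lt (b, y) by apply: lt_reach nby => //; exact: reach_refl.
exists v; split=> //; first exact: (reach_le wo Pa Py nRay).
by exists y, y'; split=> //; case.
Qed.

(** * The equivalence relation given by the reach *)

(** A witness [c] for [b] in the reach of [a] is not below [b] and satisfies f c <= f a.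
    Monotonicity puts the reach of [b] inside that of [c], and [reach_le] puts the latter inside
    that of [a]. *)
Lemma reach_subset (X : Type) (P : set X) (lt R : set (X * X)) (a b : X) :
  strict_linear_order_on P lt -> weak_order_on P R ->
  (forall a b, lt (a, b) -> reach P lt R a `<=` reach P lt R b) ->
  P a -> P b -> reach P lt R a b <-> reach P lt R b `<=` reach P lt R a.
Proof.
move=> slo wo mono Pa Pb; split=> [ab|]; last by apply; exact: reach_refl.
have [_ [c [Pc ncb nac]]] := ab.
have bc : reach P lt R b `<=` reach P lt R c.
  by have [//|<- //|bc] := slo_total slo Pc Pb; exact: mono.
exact: subset_trans bc (reach_le wo Pa Pc nac).
Qed.

(** By [reach_subset], mutual membership amounts to having equal reaches; in this form definability
    is inherited from [reach]. *)
Definition reach_equiv (X : Type) (P : set X) (lt R : set (X * X)) :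
    set (X * X) :=
  [set ab | [/\ P ab.1, P ab.2, reach P lt R ab.1 ab.2 & reach P lt R ab.2 ab.1]].

(** For the last clause: if a < b, monotonicity puts [a] in the reach of [b], so inequivalence
    forces [b] out of the reach of [a], and beyond the reach [R (a, _)] holds. *)
Lemma reach_equivP (X : Type) (P : set X) (lt R : set (X * X)) :
  strict_linear_order_on P lt -> weak_order_on P R ->
  (forall a b, lt (a, b) -> reach P lt R a `<=` reach P lt R b) ->
  [/\ equivalence_on P (reach_equiv P lt R),
      forall a b, P a -> P b -> ~ R (a, b) -> ~ R (b, a) ->
        reach_equiv P lt R (a, b) &
      forall a b, lt (a, b) -> ~ reach_equiv P lt R (a, b) -> R (a, b)].
Proof.
move=> slo wo mono; have rs := reach_subset slo wo mono; split.
- split.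
  + by move=> [a b] [].
  + by move=> a Pa; split=> //; exact: reach_refl.
  + by move=> a b [].
  + move=> a b c [/= Pa Pb ab ba] [/= _ Pc bc cb]; split=> //=.
      exact: ((rs a b Pa Pb).1 ab).
    exact: ((rs c b Pc Pb).1 cb).
- move=> a b Pa Pb nab nba; split=> //=.
    by apply: (reach_le wo Pa Pb nab); exact: reach_refl.
  by apply: (reach_le wo Pb Pa nba); exact: reach_refl.
- move=> a b ab nE; have [Pa Pb] := slo_sub slo ab.
  apply: (rel_of_not_reach slo Pb) => rab; apply: nE; split=> //=.
  by apply: (mono a b ab); exact: reach_refl.
Qed.

(** A symmetry would carry a maximum to any given point, making both [b] and [c] maximal. *)
Lemma homogeneous_no_max (X : Type) (P : set X) (lt R : set (X * X)) (b c : X) :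
  strict_linear_order_on P lt -> homogeneous P lt R -> P b -> P c -> b <> c ->
  forall z, P z -> exists x, lt (z, x).
Proof.
move=> slo hom Pb Pc nbc z Pz; apply: contrapT => zmax.
have amax a : P a -> forall x, ~ lt (a, x).
  move=> /(hom _ _ Pz)[sigma ssig <-] x.
  have [x' <-] := sym_surj ssig x.
  by move=> /(sym_lt ssig) zx; apply: zmax; exists x'.
by have [/(amax b Pb)|/nbc|/(amax c Pc)] := slo_total slo Pb Pc.
Qed.

(** Both [R (a, _)] and [R (_, a)] are eventually constant. If both are eventually false,
    homogeneity gives the same for [b] and [c]; a far enough [w] is then incomparable to both, and
    negative transitivity through [w] contradicts [R (b, c)]. *)
Lemma eventually_comparable (X : Type) (P : set X) (lt R : set (X * X))
    (a b c : X) :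
  strict_linear_order_on P lt -> weak_order_on P R -> homogeneous P lt R ->
  finite_set (convex_components lt [set x | P x /\ R (a, x)]) ->
  finite_set (convex_components lt [set x | P x /\ R (x, a)]) ->
  P a -> P b -> P c -> R (b, c) ->
  exists2 z, P z &
    (forall x, lt (z, x) -> R (a, x)) \/ (forall x, lt (z, x) -> R (x, a)).
Proof.
move=> slo wo hom finl finr Pa Pb Pc bc.
have nbc : b <> c by move=> E; apply: (wo_irr wo Pb); rewrite {2}E.
have nomax := homogeneous_no_max slo hom Pb Pc nbc.
have [z Pz [zR|zl]] := eventually_constant slo (@subIsetl _ P _) finl Pa.
  by exists z => //; left=> x /zR[].
have [z' Pz' [z'R|z'l]] := eventually_constant slo (@subIsetl _ P _) finr Pa.
  by exists z' => //; right=> x /z'R[].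
have join u v : P u -> P v -> exists w, lt (u, w) /\ lt (v, w).
  move=> Pu Pv; have [uv|<-|vu] := slo_total slo Pu Pv.
  - have [w vw] := nomax v Pv; exists w; split=> //; exact: (slo_trans slo uv vw).
  - by have [w uw] := nomax u Pu; exists w.
  - have [w uw] := nomax u Pu; exists w; split=> //; exact: (slo_trans slo vu uw).
have incomparable d : P d ->
    exists2 u, P u & forall x, lt (u, x) -> ~ R (d, x) /\ ~ R (x, d).
  move=> /(hom _ _ Pa)[sigma ssig <-].
  have [u [zu z'u]] := join z z' Pz Pz'.
  have [_ Pu] := slo_sub slo zu.
  exists (sigma u); first exact/(sym_dom ssig).
  move=> x; have [v <-] := sym_surj ssig x => /(sym_lt ssig) uv.
  have [_ Pv] := slo_sub slo uv.
  split=> /(sym_rel ssig) h.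
    by apply: (zl v (slo_trans slo zu uv)); split=> //; exact: h.
  by apply: (z'l v (slo_trans slo z'u uv)); split=> //; exact: h.
have [u Pu hu] := incomparable b Pb; have [v Pv hv] := incomparable c Pc.
have [w [/hu[nbw _] /[dup] vw /hv[_ nwc]]] := join u v Pu Pv.
have [_ Pw] := slo_sub slo vw.
by case: (wo_negtrans wo Pb Pw Pc nbw nwc bc).
Qed.

(** * The equivalence relation of a function *)

(** Compactness applied to projections: [t] and [t'] are witnesses for two incompatible conditions
    on [e]. *)
Lemma separation (K : Type) (L : language) (M : structure L) (A : params M)
    (V : sorts L -> Type) (w w' : seq (sorts L))
    (X : set (valuation M (sumvars V (vars w))))
    (X' : set (valuation M (sumvars V (vars w')))) :
  saturated K M -> small_params K A -> finite_vars V ->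
  type_definable A X -> type_definable A X' ->
  (forall e t t', X (join_val e t) -> X' (join_val e t') -> False) ->
  exists Z, [/\ definable_in A Z, forall e t, X (join_val e t) -> Z e &
    forall e t, X' (join_val e t) -> ~ Z e].
Proof.
move=> sat smallA fV tX tX' XX'.
pose W := sumvars (sumvars V (vars w)) (vars w').
pose r s (v : sumvars V (vars w) s) : W s := inl v.
pose r' s (v : sumvars V (vars w') s) : W s :=
  match v with inl v => inl (inl v) | inr v => inr v end.
have rE (e : valuation M V) t t' :
  pull r (join_val (join_val e t) t') = join_val e t by [].
have rE' (e : valuation M V) t t' :
    pull r' (join_val (join_val e t) t') = join_val e t'.
  by apply: valuation_ext => s [].
have fW : finite_vars W by do 2!apply: finite_vars_sum.
have [|Y [Y' [dY dY' XY XY' YY']]] := compactness sat smallA fW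
  (type_definable_pull (r := r) tX) (type_definable_pull (r := r') tX').
  move=> e.
  have -> : e = join_val (join_val (fun s v => e s (inl (inl v)))
      (fun s v => e s (inl (inr v)))) (fun s v => e s (inr v)).
    by apply: valuation_ext => s [[]|].
  by move=> [] /=; rewrite rE'; exact: XX'.
(* The separating set says that some [t] works for all [t'] in [Y]. It contains the projection of
   [X], whose pullback ignores [t'], and misses that of [X'], whose pullback ignores [t]. *)
exists [set e | exists t, ~ exists t', ~ Y (join_val (join_val e t) t')]; split.
- apply: (definable_ex (X := [set e | ~ exists t', ~ Y (join_val e t')])).
  apply: (definable_setC (X := [set e | exists t', ~ Y (join_val e t')])).
  apply: (definable_ex (X := ~` Y)); exact: definable_setC.
- by move=> e t Xet; exists t => -[t']; apply; apply: XY; rewrite /= rE.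
- move=> e t' X'et' [t]; apply; exists t' => Yett'.
  by apply: (YY' (join_val (join_val e t) t')); split=> //; apply: XY'; rewrite /= rE'.
Qed.

Definition swap (S : Type) (V W : S -> Type) (s : S) (v : sumvars V W s) :
    sumvars W V s :=
  match v with inl v => inr v | inr v => inl v end.

Lemma pull_swap (S : Type) (M V W : S -> Type) (e : valuation M V)
    (e' : valuation M W) : pull (@swap S W V) (join_val e e') = join_val e' e.
Proof. by apply: valuation_ext => s []. Qed.

Lemma rel_definable2P (L : language) (M : structure L) (A : params M)
    (x y : seq (sorts L)) (P : set (tuples M x)) (Q : set (tuples M y))
    (R : set (tuples M x * tuples M y)) :
  rel_definable2 A P Q R <->
  exists Z : set (valuation M (sumvars (vars x) (vars y))),
    definable_in A Z /\
    forall a b, R (a, b) <-> [/\ Z (join_val a b), P a & Q b].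
Proof.
split.
  move=> [_ [phi ->] ->]; exists [set e | sat_over phi e].
  by split; [exists phi|move=> a b; split=> [[? []]|[? ? ?]]].
move=> [_ [[phi ->] RE]].
exists [set ab | sat_over phi (join_val ab.1 ab.2)]; first by exists phi.
apply/seteqP; split=> -[a b]; first by move=> /RE[].
by move=> [? [? ?]]; apply/RE.
Qed.

Lemma realizations_automorphism (L : language) (M : structure L) (A : params M)
    (x : seq (sorts L)) (p : ptype A x) (sigma : forall s, M s -> M s)
    (a : tuples M x) :
  automorphism_over A sigma -> realizations p (act sigma a) <-> realizations p a.
Proof.
move=> auts.
have E phi : sat_over phi (act sigma a) <-> sat_over (B := A) phi a.
  have dphi : definable_in A [set e | sat_over (B := A) phi e] by exists phi.
  exact: (definable_automorphism a auts dphi).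
by split=> h phi /h; rewrite /= E.
Qed.

Lemma complete_type_automorphism (K : Type) (L : language) (M : structure L)
    (A : params M) (x : seq (sorts L)) (p : ptype A x) (a b : tuples M x) :
  strongly_homogeneous K M -> small K nat -> small_params K A ->
  complete_type p -> realizations p a -> realizations p b ->
  exists2 sigma, automorphism_over A sigma & act sigma a = b.
Proof.
move=> hom Knat smallA [_ pc] pa pb.
apply: (same_type_automorphism hom (small_tuple_sum x Knat smallA)).
move=> phi; have [pphi|pn] := pc phi; first by split=> _; [exact: pb|exact: pa].
by split=> h; [case: (pa _ pn)|case: (pb _ pn)].
Qed.

Lemma finite_components_fiber (L : language) (M : structure L) (A : params M)
    (x : seq (sorts L)) (p : ptype A x) (lt : set (tuples M x * tuples M x))
    (Z : set (valuation M (sumvars (vars x) (vars x)))) (c : tuples M x)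
    (X : set (tuples M x)) :
  weakly_o_minimal_pair p lt -> definable_in A Z ->
  (forall a, X a <-> realizations p a /\ Z (join_val a c)) ->
  finite_set (convex_components lt X).
Proof.
move=> [_ _ _ fin] dZ XE; apply: fin.
exists [set a | Z (join_val a c)]; first exact: definable_fiber dZ.
by apply/seteqP; split=> a; [move=> /XE[]|move=> [? ?]; apply/XE].
Qed.

(** Membership in the reach and, thanks to [reach_tail], non-membership are both projections of sets
    type-definable over [A]; [separation] then yields one [A]-definable set that decides between
    them. *)
Lemma reach_definable (K : Type) (L : language) (M : structure L)
    (A : params M) (x : seq (sorts L)) (p : ptype A x)
    (lt R : set (tuples M x * tuples M x))
    (Z : set (valuation M (sumvars (vars x) (vars x)))) (a0 : tuples M x) :
  let P := realizations p in
  small K nat -> small_params K A -> saturated K M -> strongly_homogeneous K M ->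
  weakly_o_minimal_pair p lt -> weak_order_on P R ->
  definable_in A Z -> (forall a b, P a -> P b -> R (a, b) <-> Z (join_val a b)) ->
  (forall sigma, automorphism_over A sigma -> symmetry P lt R (act sigma)) ->
  P a0 ->
  exists Z' : set (valuation M (sumvars (vars x) (vars x))), definable_in A Z' /\
    forall a b, P a -> P b -> reach P lt R a b <-> Z' (join_val a b).
Proof.
move=> P Knat smallA sat hom wom wo dZ RZ symP Pa0.
have [pc dlt slo _] := wom.
have [Zlt [dZlt ltE]] := (rel_definable2P _ _ _ _).1 dlt.
have [z0 az0 tail] : exists2 z, reach P lt R a0 z &
    forall x, lt (z, x) -> R (a0, x) -> ~ reach P lt R a0 x.
  apply: reach_tail => //.
  apply: (finite_components_fiber (c := a0) wom
    (definable_pull (@swap _ (vars x) (vars x)) dZ)).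
  move=> a /=; rewrite pull_swap.
  by split=> -[Pa] /(RZ _ _ Pa0 Pa).
have Pz0 : P z0 by have [] := az0.
pose V := sumvars (vars x) (vars x).
pose r1 s (v : vars x s) : sumvars V (vars x) s := inl (inl v).
pose r2 s (v : vars x s) : sumvars V (vars x) s := inl (inr v).
pose r3 s (v : vars x s) : sumvars V (vars x) s := inr v.
pose rr q q' s (v : V s) : sumvars V (vars x) s :=
  match v with inl v => q s v | inr v => q' s v end.
have tP r := type_definable_pull (r := r) (type_definable_realizations (p := p)).
(* [X] says that [c] witnesses [b \in reach a]; [X'] that [z] witnesses
   [b \notin reach a], being to [a] as [z0] is to [a0]. *)
pose X : set (valuation M (sumvars V (vars x))) :=
  ([set e | P (pull r1 e)] `&` [set e | P (pull r2 e)] `&` [set e | P (pull r3 e)]) `&`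
  ([set e | ~ Zlt (pull (rr r3 r2) e)] `&` [set e | ~ Z (pull (rr r1 r3) e)]).
pose X' : set (valuation M (sumvars V (vars x))) :=
  ([set e | P (pull r2 e)] `&`
   [set e | forall phi : formula_over A V,
      sat_over phi (join_val a0 z0) <-> sat_over phi (pull (rr r1 r3) e)]) `&`
  ([set e | Zlt (pull (rr r3 r2) e)] `&` [set e | Z (pull (rr r1 r2) e)]).
have tX : type_definable A X.
  do !apply: type_definable_setI; try exact: tP.
    by apply: definable_type_definable; exact: definable_pull (definable_setC dZlt).
  by apply: definable_type_definable; exact: definable_pull (definable_setC dZ).
have tX' : type_definable A X'.
  do !apply: type_definable_setI; first exact: tP.
  - exact: type_definable_pull (type_definable_same_type (c := join_val a0 z0)).
  - by apply: definable_type_definable; exact: definable_pull.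
  - by apply: definable_type_definable; exact: definable_pull.
have XE a b c : X (join_val (join_val a b) c) <->
    [/\ P a, P b, P c, ~ Zlt (join_val c b) & ~ Z (join_val a c)].
  have E1 : pull (rr r3 r2) (join_val (join_val a b) c) = join_val c b.
    by apply: valuation_ext => s [].
  have E2 : pull (rr r1 r3) (join_val (join_val a b) c) = join_val a c.
    by apply: valuation_ext => s [].
  by rewrite /X /= E1 E2; split=> [[[[? ?] ?] []]|[]].
have X'E a b z : X' (join_val (join_val a b) z) <->
    [/\ P b, forall phi : formula_over A V,
      sat_over phi (join_val a0 z0) <-> sat_over phi (join_val a z),
      Zlt (join_val z b) & Z (join_val a b)].
  have E1 : pull (rr r3 r2) (join_val (join_val a b) z) = join_val z b.
    by apply: valuation_ext => s [].
  have E2 : pull (rr r1 r3) (join_val (join_val a b) z) = join_val a z.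
    by apply: valuation_ext => s [].
  have E3 : pull (rr r1 r2) (join_val (join_val a b) z) = join_val a b.
    by apply: valuation_ext => s [].
  by rewrite /X' /= E1 E2 E3; split=> [[[? ?] []]|[]].
have act_join sigma (a z : tuples M x) :
  act sigma (join_val a z) = join_val (act sigma a) (act sigma z).
  by apply: valuation_ext => s [].
have split_join (a a' z z' : tuples M x) :
    join_val a z = join_val a' z' -> a = a' /\ z = z'.
  move=> E; split; apply: valuation_ext => s v.
    exact: (congr1 (fun e : valuation M V => e s (inl v)) E).
  exact: (congr1 (fun e : valuation M V => e s (inr v)) E).
have fV : finite_vars V by apply: finite_vars_sum; exact: finite_vars_tuple.
have [|Z' [dZ' XZ' X'Z']] := separation sat smallA fV tX tX'.
  move=> e c z.
  have -> : e = join_val (fun s v => e s (inl v)) (fun s v => e s (inr v)).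
    exact: join_pull.
  move: (fun s v => e s (inl v)) (fun s v => e s (inr v)) => a b.
  move=> /XE[Pa Pb Pc ncb nac] /X'E[_ st zb ab].
  have [sigma auts] := same_type_automorphism hom
    (small_tuple_pair_sum x Knat smallA) st.
  rewrite act_join => /split_join[Ea Ez].
  have ssig := symP sigma auts.
  have [b' b'E] := act_surj b auts.1.
  have Pz : P z by rewrite -Ez; exact/(sym_dom ssig).
  have {}zb : lt (z, b) by apply/ltE.
  have {}ab : R (a, b) by apply/RZ.
  have Pb' : P b' by apply/(sym_dom ssig); rewrite b'E.
  (* Pulled back along the automorphism taking (a0, z0) to (a, z), the point [b] becomes a [b'] in
     the reach of [a0], beyond [z0] and with [R (a0, b')]: exactly what [tail] excludes. *)
  apply: (tail b').
  - by apply/(sym_lt ssig); rewrite b'E Ez.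
  - by apply/(sym_rel ssig) => //; rewrite b'E Ea.
  - apply/(reach_symmetry _ ssig Pa0); rewrite b'E Ea; split=> //.
    exists c; split=> //; first by move=> /ltE[].
    by move=> /RZ; auto.
exists Z'; split=> // a b Pa Pb; split.
  move=> [_ [c [Pc nlt nR]]]; apply: (XZ' _ c); apply/XE; split=> //.
    by move=> cb; apply: nlt; apply/ltE.
  by move=> /RZ; auto.
move=> Z'ab; apply: contrapT => nab.
have [sigma auts aE] := complete_type_automorphism hom Knat smallA pc Pa0 Pa.
have ssig := symP sigma auts.
(* The image of [z0] under an automorphism taking [a0] to [a] witnesses non-membership: it is in the
   reach of [a], hence below [b]. *)
apply: (X'Z' (join_val a b) (act sigma z0)) => //; apply/X'E; split=> //.
- move=> phi; rewrite -aE -act_join.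
  have dphi : definable_in A [set e | sat_over (B := A) phi e] by exists phi.
  exact: iff_sym (definable_automorphism (join_val a0 z0) auts dphi).
- suff /ltE[] : lt (act sigma z0, b) by [].
  apply: lt_reach nab => //; rewrite -aE.
  exact/(reach_symmetry _ ssig Pa0).
- by apply/RZ => //; exact: rel_of_not_reach nab.
Qed.

Lemma automorphism_symmetry (L : language) (M : structure L) (A : params M)
    (x : seq (sorts L)) (p : ptype A x) (lt R : set (tuples M x * tuples M x))
    (Z : set (valuation M (sumvars (vars x) (vars x))))
    (sigma : forall s, M s -> M s) :
  let P := realizations p in
  rel_definable2 A P P lt -> definable_in A Z ->
  (forall a b, P a -> P b -> R (a, b) <-> Z (join_val a b)) ->
  automorphism_over A sigma -> symmetry P lt R (act sigma).
Proof.
move=> P /rel_definable2P[Zlt [dZlt ltE0]] dZ RZ auts.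
have ltE a b : lt (a, b) <-> [/\ Zlt (join_val a b), P a & P b] := ltE0 a b.
have act_join (a z : tuples M x) :
  act sigma (join_val a z) = join_val (act sigma a) (act sigma z).
  by apply: valuation_ext => s [].
have PE a : P (act sigma a) <-> P a by exact: realizations_automorphism.
split=> //.
- move=> a b; have := definable_automorphism (join_val a b) auts dZlt.
  rewrite act_join => ZE; split=> /ltE[/ZE Zab /PE Pa /PE Pb]; apply/ltE; split=> //; first [exact/PE|exact/ZE].
- move=> a b Pa Pb; have := definable_automorphism (join_val a b) auts dZ.
  rewrite act_join => ZE; have Pa' := (PE a).2 Pa; have Pb' := (PE b).2 Pb.
  by split=> [/(RZ _ _ Pa' Pb')/ZE|/(RZ _ _ Pa Pb)/ZE] ?; exact/RZ.
- by move=> b; exact: act_surj auts.1.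
Qed.

Lemma exists_reach_equiv (K : Type) (L : language) (M : structure L)
    (A : params M) (x : seq (sorts L)) (p : ptype A x)
    (lt R : set (tuples M x * tuples M x))
    (Z : set (valuation M (sumvars (vars x) (vars x)))) (a0 z0 : tuples M x) :
  let P := realizations p in
  small K nat -> small_params K A -> saturated K M -> strongly_homogeneous K M ->
  weakly_o_minimal_pair p lt -> weak_order_on P R ->
  definable_in A Z -> (forall a b, P a -> P b -> R (a, b) <-> Z (join_val a b)) ->
  P a0 -> (exists z, lt (z0, z)) -> (forall z, lt (z0, z) -> R (a0, z)) ->
  exists E, [/\ rel_definable_equivalences p E, E <> full_rel p,
    forall a b, P a -> P b -> ~ R (a, b) -> ~ R (b, a) -> E (a, b) &
    forall a b, lt (a, b) -> ~ E (a, b) -> R (a, b)].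
Proof.
move=> P Knat smallA sat hom wom wo dZ RZ Pa0 [z1 z01] ev.
have [pc dlt slo _] := wom.
have symP sigma : automorphism_over A sigma -> symmetry P lt R (act sigma).
  exact: (automorphism_symmetry dlt dZ RZ).
have homP : homogeneous P lt R.
  move=> a b Pa Pb.
  have [sigma /symP ssig E] := complete_type_automorphism hom Knat smallA pc Pa Pb.
  by exists (act sigma).
have [Z' [dZ' reachE]] :=
  reach_definable Knat smallA sat hom wom wo dZ RZ symP Pa0.
have mono a b : lt (a, b) -> reach P lt R a `<=` reach P lt R b.
  apply: reach_monotone => // z Pz.
  apply: (finite_components_fiber (c := z) wom (definable_setC dZ')) => u.
  by split=> -[Pu nr]; split=> // /(reachE _ _ Pu Pz).
have [eqvE kerE ltR] := reach_equivP slo wo mono.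
exists (reach_equiv P lt R); split=> //.
- split=> //; apply/rel_definable2P.
  exists (Z' `&` [set e | Z' (pull (@swap _ (vars x) (vars x)) e)]); split.
    by apply: definable_setI => //; exact: definable_pull.
  move=> a b /=; rewrite pull_swap; split=> [[/= Pa Pb ab ba]|[[ab ba] Pa Pb]].
    by split=> //; split; apply/reachE.
  by split=> //=; apply/reachE.
- have [_ Pz1] := slo_sub slo z01.
  (* The relation is proper because [a0] and [z1] are inequivalent: a witness for [z1] in the reach
     of [a0] would lie above [z0], where [R (a0, _)] holds. *)
  move=> E; have : full_rel p (a0, z1) by [].
  rewrite -E => -[/= _ _ [_ [y [Py nlt nR]]] _]; apply: nR; apply: ev.
  have [z1y|<- //|//] := slo_total slo Pz1 Py.
  exact: (slo_trans slo z01 z1y).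
Qed.

(** * Comparison of values of [f] *)

Lemma lt_image_definable (L : language) (M : structure L) (A : params M)
    (x y : seq (sorts L)) (P : set (tuples M x)) (D : set (tuples M y))
    (lt : set (tuples M y * tuples M y)) (f : tuples M x -> tuples M y) :
  definable_linear_order A D lt -> rel_definable_fun A P D f ->
  exists Z : set (valuation M (sumvars (vars x) (vars x))), definable_in A Z /\
    forall a b, P a -> P b -> lt (f a, f b) <-> Z (join_val a b).
Proof.
move=> [_ [psi ltE] slo] [fD /rel_definable2P[Zf [dZf fE]]].
pose Zl : set (valuation M (sumvars (vars y) (vars y))) :=
  [set e | sat_over psi e].
have dZl : definable_in A Zl by exists psi.
have {}ltE u v : lt (u, v) <-> Zl (join_val u v) by rewrite ltE.
pose V := sumvars (vars x) (vars x).
pose W := sumvars (sumvars V (vars y)) (vars y).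
pose r1 s (v : sumvars (vars x) (vars y) s) : W s :=
  match v with inl v => inl (inl (inl v)) | inr v => inl (inr v) end.
pose r2 s (v : sumvars (vars x) (vars y) s) : W s :=
  match v with inl v => inl (inl (inr v)) | inr v => inr v end.
pose r3 s (v : sumvars (vars y) (vars y) s) : W s :=
  match v with inl v => inl (inr v) | inr v => inr v end.
pose Y : set (valuation M W) := [set e | Zf (pull r1 e)] `&`
  ([set e | Zf (pull r2 e)] `&` [set e | Zl (pull r3 e)]).
have YE a b u v : Y (join_val (join_val (join_val a b) u) v) <->
    [/\ Zf (join_val a u), Zf (join_val b v) & Zl (join_val u v)].
  set e := join_val _ _.
  have E1 : pull r1 e = join_val a u by apply: valuation_ext => s [].
  have E2 : pull r2 e = join_val b v by apply: valuation_ext => s [].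
  have E3 : pull r3 e = join_val u v by apply: valuation_ext => s [].
  by rewrite /Y /= E1 E2 E3; split=> [[? []]|[]].
have dY : definable_in A Y.
  by do !apply: definable_setI; exact: definable_pull.
exists [set e | exists u v, Y (join_val (join_val e u) v)]; split.
  apply: (definable_ex (X := [set e | exists v, Y (join_val e v)])).
  exact: definable_ex.
have graph a : P a -> Zf (join_val a (f a)).
  by move=> Pa; have /fE[] : P a /\ f a = f a by [].
move=> a b Pa Pb; split.
  by move=> /ltE h; exists (f a), (f b); apply/YE; split=> //; exact: graph.
(* [Zf] is the graph of [f] only relative to [P] and [D]. That [u] and [v] are in [D] comes from u <
   v, and this identifies them with the values of [f]. *)
move=> [u [v /YE[Zau Zbv /ltE uv]]]; have [Du Dv] := slo_sub slo uv.
have /fE[_ /= <-] : [/\ Zf (join_val a u), P a & D u] by [].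
by have /fE[_ /= <-] : [/\ Zf (join_val b v), P b & D v] by [].
Qed.

Definition converse (X : Type) (R : set (X * X)) : set (X * X) :=
  [set ab | R (ab.2, ab.1)].

Lemma converse_linear_order (L : language) (M : structure L) (A : params M)
    (y : seq (sorts L)) (D : set (tuples M y)) (lt : set (tuples M y * tuples M y)) :
  definable_linear_order A D lt -> definable_linear_order A D (converse lt).
Proof.
move=> [dD [psi ltE] [sub irr tr tot]]; split=> //.
  have [] := definable_pull (@swap _ (vars y) (vars y))
    (ex_intro _ psi erefl : definable_in A [set e | sat_over psi e]).
  move=> phi phiE; exists phi; rewrite /converse ltE.
  apply/seteqP; split=> -[a b] /=;
    rewrite -[sat_over phi _]/([set e | sat_over phi e] _) -phiE /= pull_swap //.
split.
- by move=> [a b] /sub[].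
- by move=> a /irr.
- by move=> a b c ba cb; exact: tr cb ba.
- by move=> a b Da Db; have [h|h|h] := tot a b Da Db; [apply: Or33|apply: Or32|apply: Or31].
Qed.

Lemma weak_order_image (X Y : Type) (P : set X) (D : set Y) (lt : set (Y * Y))
    (f : X -> Y) :
  strict_linear_order_on D lt -> set_fun P D f ->
  weak_order_on P [set ab | lt (f ab.1, f ab.2)].
Proof.
move=> [sub irr tr tot] fD; split=> [a _|a b c /fD Da /fD Db /fD Dc /= nab nbc ac].
  exact: irr.
have [//|E|ba] := tot _ _ Da Db; first by apply: nbc; rewrite -E.
by apply: nbc; exact: tr ba ac.
Qed.

Lemma exists_monotone_equivalence (K : Type) (L : language) (M : structure L)
    (A : params M) (x y : seq (sorts L)) (p : ptype A x)
    (lt : set (tuples M x * tuples M x)) (D : set (tuples M y))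
    (ltD : set (tuples M y * tuples M y)) (f : tuples M x -> tuples M y) :
  let P := realizations p in
  small K nat -> small_params K A -> saturated K M -> strongly_homogeneous K M ->
  weakly_o_minimal_pair p lt -> definable_linear_order A D ltD ->
  rel_definable_fun A P D f ->
  (exists a b, [/\ P a, P b & f a <> f b]) ->
  exists E, [/\ rel_definable_equivalences p E, E <> full_rel p,
    forall a b, P a -> P b -> f a = f b -> E (a, b) &
    (forall a b, lt (a, b) -> ~ E (a, b) -> ltD (f a, f b)) \/
    (forall a b, lt (a, b) -> ~ E (a, b) -> ltD (f b, f a))].
Proof.
move=> P Knat smallA sat hom wom dlo fdef [a [b [Pa Pb nfab]]].
have [pc dlt slo _] := wom; have [_ _ sloD] := dlo; have [fD _] := fdef.
wlog ab : a b Pa Pb nfab / ltD (f a, f b).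
  move=> gen; have [h|//|h] := slo_total sloD (fD _ Pa) (fD _ Pb); first exact: (gen a b).
  by apply: (gen b a) => // /esym.
pose R := [set ab | ltD (f ab.1, f ab.2)].
have [Z [dZ RZ]] := lt_image_definable dlo fdef.
have wo : weak_order_on P R := weak_order_image sloD fD.
have homP : homogeneous P lt R.
  move=> u v Pu Pv.
  have [sigma auts E] := complete_type_automorphism hom Knat smallA pc Pu Pv.
  by exists (act sigma) => //; exact: (automorphism_symmetry dlt dZ RZ).
have nab : a <> b by move=> E; apply: nfab; rewrite E.
have [z Pz ev] : exists2 z, P z &
    (forall x, lt (z, x) -> R (a, x)) \/ (forall x, lt (z, x) -> R (x, a)).
  apply: (eventually_comparable slo wo homP _ _ Pa Pa Pb ab).
    apply: (finite_components_fiber (c := a) wom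
      (definable_pull (@swap _ (vars x) (vars x)) dZ)) => u /=.
    by rewrite pull_swap; split=> -[Pu] /(RZ _ _ Pa Pu).
  apply: (finite_components_fiber (c := a) wom dZ) => u /=.
  by split=> -[Pu] /(RZ _ _ Pu Pa).
have zmax := homogeneous_no_max slo homP Pa Pb nab Pz.
case: ev => ev.
  have [E [EE nE kerE mono]] := exists_reach_equiv Knat smallA sat hom wom wo dZ
    RZ Pa zmax ev.
  exists E; split=> //; last by left.
  by move=> u v Pu Pv fuv; apply: kerE => //; rewrite /R /= fuv; exact: (slo_irr sloD).
(* Here f x < f a for all large x; reversing the order of [D] restores the previous case and
   produces the decreasing alternative. *)
have dlo' := converse_linear_order dlo; have [_ _ sloD'] := dlo'.
have [Z' [dZ' RZ']] := lt_image_definable dlo' fdef.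
have [E [EE nE kerE mono]] := exists_reach_equiv
  (R := [set ab | converse ltD (f ab.1, f ab.2)])
  Knat smallA sat hom wom (weak_order_image sloD' fD) dZ' RZ' Pa zmax ev.
exists E; split=> //; last by right.
by move=> u v Pu Pv fuv; apply: kerE => //; rewrite /= fuv; exact: (slo_irr sloD').
Qed.

(** * Classes and their images under [f] *)

Lemma set_lt_eqclass (X : Type) (P : set X) (lt E : set (X * X)) (a b : X) :
  strict_linear_order_on P lt -> equivalence_on P E -> P a -> P b ->
  set_lt lt (eqclass E a) (eqclass E b) -> lt (a, b) /\ ~ E (a, b).
Proof.
move=> slo eqv Pa Pb h; have bb := eqv_refl eqv Pb; split.
  by apply: h => //; exact: (eqv_refl eqv).
by move=> ab; apply: (slo_irr slo (a := b)); exact: h.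
Qed.

Lemma image_rel_eqclass (X Y : Type) (P : set X) (E : set (X * X)) (f : X -> Y)
    (b : X) :
  equivalence_on P E -> (forall a b, P a -> P b -> f a = f b -> E (a, b)) ->
  P b -> eqclass (image_rel f E) (f b) = f @` eqclass E b.
Proof.
move=> eqv kerE Pb; apply/seteqP; split=> c.
  move=> [[u v] /= uv [fu <-]]; exists v => //.
  have [Pu _] := eqv_sub eqv uv.
  exact: (eqv_trans eqv (kerE _ _ Pb Pu (esym fu)) uv).
by move=> [v bv <-]; exists (b, v).
Qed.

(** Only transitivity relies on [E] containing the kernel of [f]: two composable pairs of the image
    share a value, and their preimages of it must be equivalent. *)
Lemma equivalence_on_image (X Y : Type) (P : set X) (E : set (X * X)) (f : X -> Y) :
  equivalence_on P E -> (forall a b, P a -> P b -> f a = f b -> E (a, b)) ->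
  equivalence_on (f @` P) (image_rel f E).
Proof.
move=> eqv kerE; split.
- move=> _ [[u v] uv <-]; have [Pu Pv] := eqv_sub eqv uv.
  by split; [exists u|exists v].
- by move=> _ [a Pa <-]; exists (a, a) => //; exact: (eqv_refl eqv).
- by move=> _ _ [[u v] uv [<- <-]]; exists (v, u) => //; exact: (eqv_sym eqv).
- move=> _ _ _ [[u v] uv [<- <-]] [[v' w] /= vw [fv <-]].
  have [_ Pv] := eqv_sub eqv uv; have [Pv' _] := eqv_sub eqv vw.
  exists (u, w) => //; apply: (eqv_trans eqv uv).
  exact: (eqv_trans eqv (kerE _ _ Pv Pv' (esym fv)) vw).
Qed.

Unset Implicit Arguments.

Theorem theorem3p6 (L : language) (T : set (sentence L)) (K : Type)
    (C : structure L) (A : params C) (x y : seq (sorts L))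
    (p : ptype A x) (lt_p : set (tuples C x * tuples C x))
    (D : set (tuples C y)) (lt_D : set (tuples C y * tuples C y))
    (f : tuples C x -> tuples C y) :
  complete_theory T ->
  monster_model K T C ->
  small_params K A ->
  weakly_o_minimal_pair p lt_p ->
  definable_linear_order A D lt_D ->
  rel_definable_fun A (realizations p) D f ->
  (exists a b, [/\ realizations p a, realizations p b & f a <> f b]) ->
  (exists E, [/\ rel_definable_equivalences p E, E <> full_rel p &
     (forall x1 x2, realizations p x1 -> realizations p x2 ->
        set_lt lt_p (eqclass E x1) (eqclass E x2) -> lt_D (f x1, f x2)) \/
     (forall x1 x2, realizations p x1 -> realizations p x2 ->
        set_lt lt_p (eqclass E x1) (eqclass E x2) -> lt_D (f x2, f x1))])
  /\
  (forall a, realizations p a ->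
     let q := tp A (f a) in
     [/\ forall b, realizations p b -> tp A (f b) = q,
         f @` realizations p = realizations q &
         exists E,
           [/\ rel_definable_equivalences p E, E <> full_rel p,
               equivalence_on (realizations q) (image_rel f E) &
               exists f_E : set (tuples C x) -> set (tuples C y),
                 [/\ set_fun (quotient (realizations p) E)
                       (quotient (realizations q) (image_rel f E)) f_E,
                     forall b, realizations p b ->
                       f_E (eqclass E b) = eqclass (image_rel f E) (f b) &
                     strictly_monotone_on_classes lt_p lt_D
                       (quotient (realizations p) E) f_E]]]).
Proof.
move=> _ [Knat _ _ _ _ sat hom] smallA wom dlo fdef nconst.
have [pc _ slo _] := wom.
have [E [EE nE kerE mono]] :=
  exists_monotone_equivalence Knat smallA sat hom wom dlo fdef nconst.
have [_ eqv] := EE.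
split.
  exists E; split=> //.
  by case: mono => mono; [left|right] => x1 x2 P1 P2 /(set_lt_eqclass slo eqv P1 P2)[];
    exact: mono.
move=> a pa q.
(* Since the graph of [f] is relatively [A]-definable, [f] commutes with automorphisms over [A];
   this gives both the independence of [q] from [a] and the surjectivity onto its realizations. *)
have fact sigma b : automorphism_over A sigma -> realizations p b ->
    f (act sigma b) = act sigma (f b).
  move=> auts pb; have [fD /rel_definable2P[Z [dZ fE]]] := fdef.
  have [dD _ _] := dlo.
  have /fE[Zb _ _] : realizations p b /\ f b = f b by [].
  suff /fE[_ /= ->] : [/\ Z (join_val (act sigma b) (act sigma (f b))),
      realizations p (act sigma b) & D (act sigma (f b))] by [].
  split; last 1 first.
  - by apply/(definable_automorphism (f b) auts dD); exact: fD.
  - have := (definable_automorphism (join_val b (f b)) auts dZ).2 Zb.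
    by congr Z; apply: valuation_ext => s [].
  - exact/realizations_automorphism.
have sat_act sigma (phi : formula_over A (vars y)) c :
    automorphism_over A sigma -> sat_over phi (act sigma c) <-> sat_over phi c.
  move=> auts; have dphi : definable_in A [set e | sat_over phi e] by exists phi.
  exact: (definable_automorphism c auts dphi).
have tpE b : realizations p b -> tp A (f b) = q.
  move=> pb; have [sigma auts <-] :=
    complete_type_automorphism hom Knat smallA pc pa pb.
  rewrite fact //; apply/seteqP; split=> phi /=; rewrite /q /tp /=.
    by move=> /(sat_act _ _ _ auts).
  by move=> /(sat_act _ _ _ auts).
have imE : f @` realizations p = realizations q.
  apply/seteqP; split=> [_ [b pb <-] phi|c qc].
    by rewrite -(tpE b pb).
  have [phi|sigma auts fc] := same_type_automorphism hom
    (small_tuple_sum y Knat smallA) (_ : forall phi : formula_over A (vars y),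
      sat_over phi (f a) <-> sat_over phi c).
    split; first exact: qc.
    move=> cphi; apply: contrapT => nphi; exact: (qc (Not phi)).
  exists (act sigma a); first exact/realizations_automorphism.
  by rewrite fact.
have cE b : realizations p b -> f @` eqclass E b = eqclass (image_rel f E) (f b).
  by move=> pb; rewrite (image_rel_eqclass eqv kerE pb).
split=> //; exists E; split=> //.
  by rewrite -imE; exact: equivalence_on_image.
(* Taking direct images avoids choosing representatives; [cE] shows that the image of a class is a
   class. *)
exists (fun U => f @` U); split=> //.
  move=> _ [b pb <-]; exists (f b); last by rewrite cE.
  by rewrite -imE; exists b.
(* Monotonicity of the class map compares all members of the two classes, so order and inequivalence
   have to pass from [b1], [b2] to arbitrary representatives. *)
have lift_lt b1 b2 u v : realizations p b1 -> realizations p b2 ->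
    set_lt lt_p (eqclass E b1) (eqclass E b2) -> E (b1, u) -> E (b2, v) ->
    lt_p (u, v) /\ ~ E (u, v).
  move=> p1 p2 h b1u b2v; split; first exact: h.
  move=> uv; have [_ nb] := set_lt_eqclass slo eqv p1 p2 h; apply: nb.
  apply: (eqv_trans eqv b1u); apply: (eqv_trans eqv uv).
  exact: (eqv_sym eqv b2v).
case: mono => mono; [left|right] => _ _ [b1 p1 <-] [b2 p2 <-] h.
  move=> _ _ [u b1u <-] [v b2v <-].
  by have [] := lift_lt _ _ _ _ p1 p2 h b1u b2v; exact: mono.
move=> _ _ [v b2v <-] [u b1u <-].
by have [] := lift_lt _ _ _ _ p1 p2 h b1u b2v; exact: mono.
Qed.
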